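(* Let $J\in\{\tfrac12,1,\tfrac32,\dots\}$ and let $C:\mathbb R^2\to[-1,1]$ be a two-angle correlation function of the form $$C(\alpha,\beta)=\sum_{m=0}^{2J}\ \sum_{n=-2J}^{2J}\big[C_{mn}\cos(m\alpha-n\beta)+S_{mn}\sin(m\alpha-n\beta)\big]$$ with real coefficients $C_{mn},S_{mn}$. A. Let $\gamma_J:=\sqrt2\,e^{-1}\,[4J(2J+1)]^{-3/2}$. If $$\max_{\alpha,\beta}|C(\alpha,\beta)-C_{00}|\le\gamma_J\,(1-|C_{00}|),$$ then $C$ has a local hidden variable model. B. Let $C_{\rm rel}(\theta):=\sum_{m=0}^{2J}\big[C_{mm}\cos(m\theta)+S_{mm}\sin(m\theta)\big]$ (with $\theta=\alpha-\beta$) be the relational part of $C$, and let $K_J:=\sqrt2\,\pi^2J(2J+1)(4J+1)/3$. Suppose there are angles $\Theta_+,\Theta_-$ and numbers $\varepsilon\ge0$, $\Delta>0$ such that $C_{\rm rel}(\Theta_+)\ge1-\varepsilon$, $C_{\rm rel}(\Theta_-)\le1-\Delta$ and $$\varepsilon<-K_J+\sqrt{K_J^2+\tfrac{\Delta^2}{4}} .$$ Then $C$ violates a Bell inequality, namely a Braunstein–Caves inequality: there are an even integer $N\ge2$ and angles $x_1,x_3,\dots,x_{N-1}$ and $y_2,y_4,\dots,y_N$ for which $$\Big|C(x_1,y_2)+C(x_3,y_2)+C(x_3,y_4)+\cdots+C(x_{N-1},y_N)-C(x_1,y_N)\Big|>N-2 .$$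
   Context: A correlation function of two angles is a function $C(\alpha,\beta)\in[-1,1]$, arising as $C(\alpha,\beta)=\sum_{a,b\in\{\pm1\}}ab\,\mathrm P(a,b|\alpha,\beta)$. It has a local hidden variable (LHV) model if there are a probability space $(\Lambda,\mu)$ and response functions $C_A(\alpha,\lambda),C_B(\beta,\lambda)\in[-1,1]$, measurable in $\lambda$ (equivalently, $C_A(\alpha,\lambda)=\sum_{a=\pm1}a\,\mathrm P_A(a|\alpha,\lambda)$ and $C_B(\beta,\lambda)=\sum_{b=\pm1}b\,\mathrm P_B(b|\beta,\lambda)$ for local outcome probabilities), with $C(\alpha,\beta)=\int_\Lambda C_A(\alpha,\lambda)C_B(\beta,\lambda)\,d\mu(\lambda)$ for all $\alpha,\beta$. The Braunstein–Caves inequality for even $N$ and settings $x_1,x_3,\dots,x_{N-1}$ (first party), $y_2,y_4,\dots,y_N$ (second party) is $\big|\sum_{k=1}^{N/2}C(x_{2k-1},y_{2k})+\sum_{k=1}^{N/2-1}C(x_{2k+1},y_{2k})-C(x_1,y_N)\big|\le N-2$; it holds for every correlation function with an LHV model. *)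

(* Defs.v *)
From HB Require Import structures.
From mathcomp Require Import all_boot all_order all_algebra.
From mathcomp Require Import all_classical all_reals all_analysis.

Set Implicit Arguments.
Unset Strict Implicit.
Unset Printing Implicit Defensive.

Import Order.TTheory GRing.Theory Num.Theory.
Import numFieldNormedType.Exports.

Local Open Scope classical_set_scope.
Local Open Scope ring_scope.

(* [true] encodes the outcome +1 and [false] the outcome -1. *)
Definition outcome (R : realType) (a : bool) : R := if a then 1 else -1.

(* [P a b alpha beta] is the probability P(a, b | alpha, beta). *)
Definition correlation_function (R : realType) (C : R -> R -> R) : Prop :=
  (forall alpha beta : R, -1 <= C alpha beta <= 1) /\
  exists P : bool -> bool -> R -> R -> R,
    [/\ forall a b alpha beta, 0 <= P a b alpha beta,
        forall alpha beta, \sum_(a : bool) \sum_(b : bool) P a b alpha beta = 1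
      & forall alpha beta, C alpha beta =
          \sum_(a : bool) \sum_(b : bool)
            outcome R a * outcome R b * P a b alpha beta].

Definition has_LHV_model (R : realType) (C : R -> R -> R) : Prop :=
  exists (d : measure_display) (Lambda : measurableType d)
         (mu : probability Lambda R) (CA CB : R -> Lambda -> R),
    [/\ forall alpha, measurable_fun setT (CA alpha),
        forall beta, measurable_fun setT (CB beta),
        forall alpha lambda, -1 <= CA alpha lambda <= 1,
        forall beta lambda, -1 <= CB beta lambda <= 1
      & forall alpha beta, (C alpha beta)%:E =
          (\int[mu]_lambda (CA alpha lambda * CB beta lambda)%:E)%E].

(* The half-integer J is encoded by the natural number twoJ = 2J. *)
Definition spin (R : realType) (twoJ : nat) : R := twoJ%:R / 2.

(* The coefficients are indexed by m : nat and n : int; the inner sum over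
   i < 4J + 1 is the sum over n = i - 2J, that is, -2J <= n <= 2J. *)
Definition trig_form (R : realType) (twoJ : nat) (c s : nat -> int -> R)
    (alpha beta : R) : R :=
  \sum_(m < twoJ.+1) \sum_(i < twoJ.*2.+1)
    let n : int := i%:Z - twoJ%:Z in
    (c m n * cos (m%:R * alpha - n%:~R * beta)
     + s m n * sin (m%:R * alpha - n%:~R * beta)).

Definition relational_part (R : realType) (twoJ : nat) (c s : nat -> int -> R)
    (theta : R) : R :=
  \sum_(m < twoJ.+1)
    (c m m%:Z * cos (m%:R * theta) + s m m%:Z * sin (m%:R * theta)).

Definition gamma_bound (R : realType) (J : R) : R :=
  Num.sqrt 2 * expR (- 1) * (4 * J * (2 * J + 1)) `^ (- (3 / 2)).

Definition K_bound (R : realType) (J : R) : R :=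
  Num.sqrt 2 * pi ^+ 2 * J * (2 * J + 1) * (4 * J + 1) / 3.

(* Only the settings x_k with k odd and y_k with k even, 1 <= k <= N, occur. *)
Definition braunstein_caves (R : realType) (C : R -> R -> R) (N : nat)
    (x y : nat -> R) : R :=
  `| \sum_(1 <= k < N./2.+1) C (x k.*2.-1) (y k.*2)
     + \sum_(1 <= k < N./2) C (x k.*2.+1) (y k.*2)
     - C (x 1%N) (y N) |.

Definition violates_braunstein_caves (R : realType) (C : R -> R -> R) : Prop :=
  exists (N : nat) (x y : nat -> R),
    [/\ ~~ odd N, (2 <= N)%N & N%:R - 2 < braunstein_caves C N x y].

(* Main.v *)
(* Sampling at the 2L + 1 equidistant grid angles (L = 2J) drives both parts.

   A. Interpolation in alpha writes C - C00 as the sum over the grid of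
   D_j(alpha) (C(t_j, beta) - C00), where the normalized Dirichlet kernels
   satisfy |D_j| <= 1.  This is a sum of only 2L + 1 products of local
   functions, so it fits into a mixture of local deterministic terms as soon as
   (2L + 1) gamma <= 1, which gamma_J satisfies with room to spare.

   B. Averaging C over common rotations by the grid angles gives C_rel, so it is
   enough to violate the inequality with C_rel in place of C.  Take settings
   whose successive relative angles are Theta_+ + d and Theta_+ - d in
   alternation, with d = (Theta_- - Theta_+) / (N - 1); then x_1 - y_N is
   Theta_-.  Interpolation bounds the second differences of C_rel, whence each
   pair of neighbouring terms falls short of 2 by at most
   2 eps + O((N - 1)^-2), and a suitable N makes the total loss smaller than
   Delta. *)

Require Import Defs.
From HB Require Import structures.
From mathcomp Require Import all_boot all_order all_algebra.
From mathcomp Require Import all_classical all_reals all_analysis.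
From mathcomp Require Import ring lra zify.

Set Implicit Arguments.
Unset Strict Implicit.
Unset Printing Implicit Defensive.

Import Order.TTheory GRing.Theory Num.Theory.
Import numFieldNormedType.Exports.

Local Open Scope classical_set_scope.
Local Open Scope ring_scope.

(** * Finite mixtures as local hidden variable models *)

(** Nonnegative [f] follows from additivity and scaling in the measure; a signed [f] is split into
    its positive and negative parts. *)
Lemma integral_msum_dirac (R : realType) (n : nat) (w : nat -> {nonneg R})
    (f : nat -> R) :
  (\int[msum (fun k => mscale (w k) \d_k) n]_k (f k)%:E =
   (\sum_(k < n) (w k)%:num * f k)%:E)%E.
Proof.
have pos (g : nat -> R) : (forall k, 0 <= g k) ->
    (\int[msum (fun k => mscale (w k) \d_k) n]_k (g k)%:E =
     (\sum_(k < n) (w k)%:num * g k)%:E)%E.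
  move=> g0; rewrite ge0_integral_measure_sum//; last first.
    by move=> k _; rewrite lee_fin.
  rewrite -sumEFin; apply: eq_bigr => k _.
  rewrite ge0_integral_mscale//; last by move=> j _; rewrite lee_fin.
  by rewrite integral_dirac// diracT mul1e EFinM.
rewrite integralE [X in (X^\+)%E](_ : _ = EFin \o f)//.
rewrite [X in (X^\-)%E](_ : _ = EFin \o f)// funerpos funerneg.
rewrite pos; last exact: funrpos_ge0.
rewrite pos; last exact: funrneg_ge0.
rewrite -EFinB -sumrB; congr (_%:E); apply: eq_bigr => k _.
by rewrite -mulrBr; congr (_ * _); rewrite -[in RHS](funrposBneg f).
Qed.

Lemma finite_LHV_model (R : realType) (n : nat) (C : R -> R -> R)
    (w : nat -> R) (a b : R -> nat -> R) :
  (forall k, 0 <= w k) -> \sum_(k < n) w k = 1 ->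
  (forall alpha k, -1 <= a alpha k <= 1) ->
  (forall beta k, -1 <= b beta k <= 1) ->
  (forall alpha beta, C alpha beta =
     \sum_(k < n) w k * (a alpha k * b beta k)) ->
  has_LHV_model C.
Proof.
move=> w0 w1 a1 b1 CE.
pose w' k := NngNum (w0 k).
pose mu : measure nat R := msum (fun k => mscale (w' k) \d_k) n.
have muT : mu setT = 1%E.
  rewrite /mu/= /msum/= -[RHS]/((1 : R)%:E) -w1 -sumEFin.
  by apply: eq_bigr => k _; rewrite /mscale/= diracT mule1.
(* The hidden variable is the index [k]. As [mu] has mass 1, normalizing only repackages it as a
   probability; [\d_0] is the fallback for mass 0 or infinity. *)
exists _, nat, (mnormalize mu \d_0%N), a, b; split => // alpha beta.
rewrite CE (eq_measure_integral mu) ?integral_msum_dirac//.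
by move=> A _ _; rewrite /= /mnormalize muT onee_eq0/= invr1 mule1.
Qed.

(** * Cosine sums over the equidistant grid and Dirichlet interpolation *)

Lemma cosD_int2pi (R : realType) (z : int) (t : R) :
  cos (t + z%:~R * (2 * pi)) = cos t.
Proof.
have pos (n : nat) (u : R) : cos (u + n%:R * (2 * pi)) = cos u.
  by rewrite -[RHS](periodicn (@cosD2pi R) n) !mulr_natl.
case: z => n; first exact: pos.
by rewrite NegzE rmorphN mulNr -(pos n.+1) subrK.
Qed.

Lemma sinD_int2pi (R : realType) (z : int) (t : R) :
  sin (t + z%:~R * (2 * pi)) = sin t.
Proof. by rewrite -!cosBpihalf addrAC cosD_int2pi. Qed.

Definition grid (R : realType) (N j : nat) : R := 2 * pi * j%:R / N%:R.

(** Multiplication by [2 * sin h], with [2 * h] the phase step, makes the sum telescope over [p]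
    full periods; [sin h] is nonzero because 0 < |h| < pi. *)
Lemma sum_cos_grid (R : realType) (N : nat) (p : int) (t : R) :
  (0 < `|p| < N)%N -> \sum_(j < N) cos (t + p%:~R * grid R N j) = 0.
Proof.
move=> /andP[p0 pN].
have N0 : 0 < N%:R :> R by rewrite ltr0n; lia.
have N0' : N%:R != 0 :> R by rewrite gt_eqF.
pose h : R := p%:~R * pi / N%:R.
have sh : sin h != 0.
  have : 0 < sin `|h|.
    rewrite sin_gt0_pi// /h !normrM normfV (ger0_norm (pi_ge0 R)) normr_nat.
    rewrite -intr_norm -natr_absz.
    rewrite divr_gt0 ?mulr_gt0 ?pi_gt0 ?ltr0n//=; last by lia.
    by rewrite ltr_pdivrMr// mulrC ltr_pM2l ?pi_gt0// ltr_nat.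
  case: (ger0P h) => _ /lt0r_neq0 //.
  by rewrite sinN oppr_eq0.
apply: (mulfI (_ : 2 * sin h != 0)); first by rewrite mulf_neq0.
rewrite mulr0 mulr_sumr.
transitivity (\sum_(0 <= j < N)
    (sin (t - h + 2 * h * j.+1%:R) - sin (t - h + 2 * h * j%:R))).
  rewrite big_mkord; apply: eq_bigr => j _.
  rewrite (_ : p%:~R * grid R N j = 2 * h * j%:R); last first.
    by rewrite /grid/h; field.
  rewrite (_ : t - h + 2 * h * j.+1%:R = t + 2 * h * j%:R + h); last first.
    by rewrite -addn1 natrD; ring.
  rewrite (_ : t - h + 2 * h * j%:R = t + 2 * h * j%:R - h); last by ring.
  by rewrite [in RHS]sinD [in RHS]sinB; ring.
rewrite telescope_sumr// mulr0 addr0.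
rewrite (_ : 2 * h * N%:R = p%:~R * (2 * pi)); last by rewrite /h; field.
by rewrite sinD_int2pi subrr.
Qed.

Lemma sum_cos_grid_if (R : realType) (N : nat) (p : int) (t : R) :
  (`|p| < N)%N ->
  \sum_(j < N) cos (t + p%:~R * grid R N j) = if p == 0 then N%:R * cos t else 0.
Proof.
move=> pN; have [->|p0] := eqVneq p 0; last first.
  by rewrite sum_cos_grid// pN absz_gt0 p0.
under eq_bigr do rewrite mul0r addr0.
by rewrite sumr_const card_ord mulr_natl.
Qed.

(* The normalized Dirichlet kernel, that is, the Lagrange basis function at
   the grid point 0 for trigonometric polynomials of degree at most L. *)
Definition dirichlet (R : realType) (L : nat) (t : R) : R :=
  (\sum_(i < L.*2.+1) cos ((i%:Z - L%:Z)%:~R * t)) / L.*2.+1%:R.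

(** The product formula turns each summand into cosines of frequencies m - n and m + n in the grid
    angle. Both are below 2L + 1 in absolute value, so the grid sum keeps only n = m and n = -m. *)
Lemma dirichlet_interpolation (R : realType) (L : nat) (m : nat) (phi t : R) :
  (m <= L)%N ->
  cos (m%:R * t - phi) =
  \sum_(j < L.*2.+1) dirichlet L (t - grid R L.*2.+1 j)
    * cos (m%:R * grid R L.*2.+1 j - phi).
Proof.
move=> mL; set N := L.*2.+1.
have N0 : N%:R != 0 :> R by rewrite pnatr_eq0.
apply: (mulfI (_ : 2 * N%:R != 0)); first by rewrite mulf_neq0// pnatr_eq0.
rewrite [RHS]mulr_sumr.
transitivity (\sum_(j < N) \sum_(i < N)
   (cos ((i%:Z - L%:Z)%:~R * t - phi
         + (m%:Z - (i%:Z - L%:Z))%:~R * grid R N j)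
    + cos ((i%:Z - L%:Z)%:~R * t + phi
           + (- (m%:Z + (i%:Z - L%:Z)))%:~R * grid R N j))); last first.
  apply: eq_bigr => j _; rewrite /dirichlet -/N.
  rewrite [RHS](_ : _ = \sum_(i < N)
      2 * cos ((i%:Z - L%:Z)%:~R * (t - grid R N j))
        * cos (m%:R * grid R N j - phi)); last first.
    rewrite -mulr_suml -mulr_sumr.
    by set S := \sum_(i < _) _; move: (N%:R) N0 => n n0; field.
  apply: eq_bigr => i _; move: (i%:Z - L%:Z) => z.
  rewrite rmorphN rmorphB rmorphD /= -pmulrn; move: z%:~R => k.
  set g := grid R N j.
    rewrite (_ : k * t - phi + (m%:R - k) * g
               = k * (t - g) + (m%:R * g - phi)); last by ring.
  rewrite (_ : k * t + phi + - (m%:R + k) * g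
               = k * (t - g) - (m%:R * g - phi)); last by ring.
  by rewrite (cosD (k * _)) (cosB (k * _)); ring.
rewrite exchange_big/=; under eq_bigr => i _.
  rewrite big_split/= sum_cos_grid_if; last by have := ltn_ord i; rewrite /N; lia.
  rewrite sum_cos_grid_if; last by have := ltn_ord i; rewrite /N; lia.
  over.
have mL1 : (m + L < N)%N by rewrite /N; lia.
have mL2 : (L - m < N)%N by rewrite /N; lia.
(* The two families stay separate sums, so m = 0, where both surviving indices equal [L], needs no
   special case. *)
rewrite big_split/=.
rewrite (bigD1 (Ordinal mL1))//= big1 ?addr0; last first.
  move=> i /eqP ne; case: eqP => // E; exfalso; apply: ne.
  by apply: val_inj => /=; lia.
rewrite (bigD1 (Ordinal mL2))//= big1 ?addr0; last first.
  move=> i /eqP ne; case: eqP => // E; exfalso; apply: ne.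
  by apply: val_inj => /=; lia.
rewrite !ifT; try lia.
rewrite (_ : (m + L)%N%:Z - L%:Z = m%:Z); last by lia.
rewrite (_ : (L - m)%N%:Z - L%:Z = - m%:Z); last by lia.
rewrite rmorphN/= -pmulrn mulNr -[in X in _ = _ + X]cosN opprD opprK; ring.
Qed.

Lemma dirichlet_max (R : realType) (L : nat) (t : R) : `|dirichlet L t| <= 1.
Proof.
rewrite normrM normfV normr_nat ler_pdivrMr ?ltr0n// mul1r.
apply: (le_trans (ler_norm_sum _ _ _)).
apply: (le_trans (ler_sum _ (fun i _ => cos_max _))).
by rewrite sumr_const card_ord.
Qed.

(** * Elementary bounds on sine and cosine *)

Lemma norm_sin_le (R : realType) (x : R) : `|sin x| <= `|x|.
Proof.
wlog x0 : x / 0 <= x => [wl|].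
  have [/wl//|/ltW x0] := leP 0 x.
  by rewrite -normrN -sinN -(normrN x) wl// oppr_ge0.
have [|c _] := @MVT_segment R sin cos 0 x x0 (fun y _ => is_derive_sin y).
  exact/continuous_subspaceT/continuous_sin.
by rewrite sin0 !subr0 => ->; rewrite normrM ler_piMl// cos_max.
Qed.

Lemma cos_second_difference (R : realType) (t d : R) :
  `|cos (t + d) + cos (t - d) - 2 * cos t| <= d ^+ 2.
Proof.
rewrite (_ : _ - _ = - (4 * sin (d / 2) ^+ 2 * cos t)); last first.
  have dE : cos d = 1 - 2 * sin (d / 2) ^+ 2.
    rewrite [in LHS](_ : d = (d / 2) *+ 2); last by rewrite -mulr_natr; field.
    by rewrite cos_mulr2n cos2sin2 -mulr_natr; ring.
  by rewrite cosD cosB dE; ring.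
rewrite normrN normrM (le_trans (ler_piMr _ (cos_max _)))//.
have : sin (d / 2) ^+ 2 <= (d / 2) ^+ 2.
  by rewrite -ler_sqrt ?sqr_ge0// !sqrtr_sqr norm_sin_le.
rewrite ger0_norm; last by rewrite pmulr_rge0// sqr_ge0.
by lra.
Qed.

(** * Interpolation and rotation averages of the trigonometric form *)

(** A sine is a cosine whose phase is shifted by pi / 2, and [phi] is arbitrary; later it stands for
    n * beta. *)
Lemma dirichlet_interpolation_trig (R : realType) (L m : nat) (a b phi t : R) :
  (m <= L)%N ->
  a * cos (m%:R * t - phi) + b * sin (m%:R * t - phi) =
  \sum_(j < L.*2.+1) dirichlet L (t - grid R L.*2.+1 j)
    * (a * cos (m%:R * grid R L.*2.+1 j - phi)
       + b * sin (m%:R * grid R L.*2.+1 j - phi)).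
Proof.
move=> mL; rewrite -!cosBpihalf.
have E := fun phi => dirichlet_interpolation phi t mL.
rewrite -addrA -opprD (E phi) (E (phi + _)) !mulr_sumr -big_split/=; apply: eq_bigr => j _.
by rewrite -cosBpihalf -addrA -opprD; ring.
Qed.

Lemma trig_form_interpolation (R : realType) (L : nat) (c s : nat -> int -> R)
    (alpha beta : R) :
  trig_form L c s alpha beta =
  \sum_(j < L.*2.+1) dirichlet L (alpha - grid R L.*2.+1 j)
    * trig_form L c s (grid R L.*2.+1 j) beta.
Proof.
rewrite /trig_form; under [RHS]eq_bigr do rewrite mulr_sumr.
rewrite [RHS]exchange_big/=; apply: eq_bigr => m _.
under [RHS]eq_bigr do rewrite mulr_sumr.
rewrite [RHS]exchange_big/=; apply: eq_bigr => i _.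
by apply: dirichlet_interpolation_trig; rewrite -ltnS.
Qed.

Lemma relational_part_interpolation (R : realType) (L : nat)
    (c s : nat -> int -> R) (t : R) :
  relational_part L c s t =
  \sum_(j < L.*2.+1) dirichlet L (t - grid R L.*2.+1 j)
    * relational_part L c s (grid R L.*2.+1 j).
Proof.
rewrite /relational_part; under [RHS]eq_bigr do rewrite mulr_sumr.
rewrite [RHS]exchange_big/=; apply: eq_bigr => m _.
have mL : (m <= L)%N by rewrite -ltnS.
have := dirichlet_interpolation_trig (c m m) (s m m) 0 t mL.
by rewrite subr0 => ->; apply: eq_bigr => j _; rewrite subr0.
Qed.

(** Rotating both angles by g adds (m - n) g to the phase of the (m, n) term. Since |m - n| <= 2L,
    the grid sum kills every term with n different from m. *)
Lemma relational_part_average (R : realType) (L : nat) (c s : nat -> int -> R)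
    (x y : R) :
  \sum_(j < L.*2.+1)
    trig_form L c s (x + grid R L.*2.+1 j) (y + grid R L.*2.+1 j) =
  L.*2.+1%:R * relational_part L c s (x - y).
Proof.
rewrite /trig_form /relational_part exchange_big mulr_sumr/=.
apply: eq_bigr => m _; rewrite [LHS]exchange_big/=.
have mL : (m + L < L.*2.+1)%N by have := ltn_ord m; lia.
transitivity (\sum_(i < L.*2.+1) if m%:Z - (i%:Z - L%:Z) == 0 then
    L.*2.+1%:R * (c m (i%:Z - L%:Z) * cos (m%:R * x - (i%:Z - L%:Z)%:~R * y)
      + s m (i%:Z - L%:Z) * sin (m%:R * x - (i%:Z - L%:Z)%:~R * y)) else 0).
  apply: eq_bigr => i _.
  have : (absz (m%:Z - (i%:Z - L%:Z))%R < L.*2.+1)%N.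
    by have := ltn_ord m; have := ltn_ord i; lia.
  move: (i%:Z - L%:Z) => n mn.
  transitivity (\sum_(j < L.*2.+1)
     (c m n * cos (m%:R * x - n%:~R * y + (m%:Z - n)%:~R * grid R L.*2.+1 j)
    + s m n * cos (m%:R * x - n%:~R * y - pi / 2
                   + (m%:Z - n)%:~R * grid R L.*2.+1 j))).
    apply: eq_bigr => j _; rewrite -cosBpihalf rmorphB/= -pmulrn.
    by congr (_ * cos _ + _ * cos _); ring.
  rewrite big_split/= -!mulr_sumr !sum_cos_grid_if// cosBpihalf.
  by case: ifP => _; ring.
rewrite (bigD1 (Ordinal mL))//= big1 ?addr0; last first.
  move=> i /eqP ne; case: eqP => // E; exfalso; apply: ne.
  by apply: val_inj => /=; lia.
rewrite ifT; last by lia.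
rewrite (_ : (m + L)%N%:Z - L%:Z = m%:Z); last by lia.
by rewrite -pmulrn mulrBr.
Qed.

(** * Second differences and periodicity of the relational part *)

Lemma sum_sqr_centered (R : realType) (L : nat) :
  \sum_(i < L.*2.+1) ((i%:Z - L%:Z)%:~R : R) ^+ 2
    = L%:R * (L%:R + 1) * (2 * L%:R + 1) / 3.
Proof.
elim: L => [|L IH]; first by rewrite big_ord1 subrr expr0n/= !mul0r.
(* Peeling off both ends, the terms -(L + 1) and L + 1, recentres the rest for the induction
   hypothesis. *)
rewrite doubleS big_ord_recl big_ord_recr/=.
rewrite (eq_bigr (fun i : 'I_L.*2.+1 => (i%:Z - L%:Z)%:~R ^+ 2)); last first.
  by move=> i _; congr (_%:~R ^+ 2); rewrite /bump; lia.
rewrite IH (_ : (bump 0 L.*2.+1)%:Z - L.+1%:Z = L.+1%:Z); last by rewrite /bump; lia.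
by rewrite sub0r rmorphN/= -!pmulrn -!natr1; field.
Qed.

Lemma dirichlet_second_difference (R : realType) (L : nat) (t d : R) :
  `|dirichlet L (t + d) + dirichlet L (t - d) - 2 * dirichlet L t|
    <= L%:R * (L%:R + 1) * (2 * L%:R + 1) / 3 * d ^+ 2 / L.*2.+1%:R.
Proof.
rewrite /dirichlet mulrA -!mulrDl -mulrBl normrM normfV normr_nat.
rewrite ler_wpM2r ?invr_ge0// -sum_sqr_centered mulr_sumr -big_split -sumrB/=.
rewrite mulr_suml (le_trans (ler_norm_sum _ _ _))//; apply: ler_sum => i _.
by rewrite mulrDr mulrBr -exprMn cos_second_difference.
Qed.

(** The grid values are at most 1 in absolute value, so each of the 2L + 1 interpolation terms
    inherits the bound for the kernel, and the normalization cancels their number. *)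
Lemma relational_part_second_difference (R : realType) (L : nat)
    (c s : nat -> int -> R) (t d : R) :
  (forall u, `|relational_part L c s u| <= 1) ->
  `|relational_part L c s (t + d) + relational_part L c s (t - d)
    - 2 * relational_part L c s t|
    <= L%:R * (L%:R + 1) * (2 * L%:R + 1) / 3 * d ^+ 2.
Proof.
move=> rel1; rewrite !(@relational_part_interpolation _ _ _ _ (_ + _)).
rewrite (relational_part_interpolation _ _ _ t).
rewrite mulr_sumr -big_split -sumrB/= (le_trans (ler_norm_sum _ _ _))//.
set K := _ * d ^+ 2.
rewrite -[leRHS](_ : \sum_(j < L.*2.+1) (K / L.*2.+1%:R) = _); last first.
  by rewrite sumr_const card_ord -(mulr_natr (K / _)) divfK// pnatr_eq0.
apply: ler_sum => j _.
rewrite mulrA -mulrDl -mulrBl normrM (le_trans (ler_piMr _ (rel1 _)))//.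
rewrite (addrAC t d) (addrAC t (- d)); exact: dirichlet_second_difference.
Qed.

Lemma relational_part_int2pi (R : realType) (L : nat) (c s : nat -> int -> R)
    (z : int) (t : R) :
  relational_part L c s (t + z%:~R * (2 * pi)) = relational_part L c s t.
Proof.
apply: eq_bigr => m _.
rewrite (_ : m%:R * _ = m%:R * t + (m%:Z * z)%:~R * (2 * pi)).
  by rewrite cosD_int2pi sinD_int2pi.
by rewrite intrM -pmulrn; ring.
Qed.

(** * Part A: the local model for small deviations *)

Lemma sum_dirichlet (R : realType) (L : nat) (t : R) :
  \sum_(j < L.*2.+1) dirichlet L (t - grid R L.*2.+1 j) = 1.
Proof.
have := dirichlet_interpolation 0 t (leq0n L).
rewrite mul0r subr0 cos0 => ->; apply: eq_bigr => j _.
by rewrite mul0r subr0 cos0 mulr1.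
Qed.

Lemma norm_div_le1 (R : realFieldType) (x u : R) : `|x| <= u -> `|x / u| <= 1.
Proof.
move=> xu; have u0 : 0 <= u by apply: le_trans xu.
rewrite normrM normfV (ger0_norm u0).
have [->|un0] := eqVneq u 0; first by rewrite invr0 mulr0.
by rewrite ler_pdivrMr ?mul1r// lt_neqAle eq_sym un0.
Qed.

(** For [u = 0] the bound forces [x = 0]; this covers vanishing weights in the mixture below. *)
Lemma mulr_div_norm_le (R : realFieldType) (x u : R) :
  `|x| <= u -> u * (x / u) = x.
Proof.
have [->|u0 _] := eqVneq u 0; last by rewrite mulrC divfK.
by rewrite mul0r normr_le0 => /eqP.
Qed.

Lemma trig_form_LHV (R : realType) (L : nat) (C : R -> R -> R)
    (c s : nat -> int -> R) (c0 gamma : R) :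
  (forall alpha beta, C alpha beta = trig_form L c s alpha beta) ->
  0 < gamma -> L.*2.+1%:R * gamma <= 1 ->
  (forall alpha beta, `|C alpha beta - c0| <= gamma * (1 - `|c0|)) ->
  has_LHV_model C.
Proof.
move=> CE g0 g1 Cc0.
have c01 : 0 <= 1 - `|c0|.
  by rewrite -(pmulr_rge0 _ g0); exact: le_trans (Cc0 0 0).
set g := gamma * (1 - `|c0|) in Cc0.
have gge0 : 0 <= g by rewrite mulr_ge0// ltW.
have c0g : `|c0| <= 1 - L.*2.+1%:R * g.
  rewrite lerBrDr -lerBrDl /g mulrA.
  by rewrite ler_piMl.
(* Index 0 carries the constant [c0] with the leftover weight, which is at least |c0| by [c0g];
   index [j.+1] carries grid point [j]. *)
apply: (@finite_LHV_model R L.*2.+2 C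
  (fun k => if k is _.+1 then g else 1 - L.*2.+1%:R * g)
  (fun alpha k => if k is j.+1 then dirichlet L (alpha - grid R L.*2.+1 j) else 1)
  (fun beta k => if k is j.+1 then (C (grid R L.*2.+1 j) beta - c0) / g
                 else c0 / (1 - L.*2.+1%:R * g))).
- by case=> [|_] //; apply: le_trans c0g.
- by rewrite big_ord_recl/= sumr_const card_ord -(mulr_natl g) subrK.
- by move=> alpha [|j]; rewrite -ler_norml ?normr1// dirichlet_max.
- by move=> beta [|j]; rewrite -ler_norml norm_div_le1.
move=> alpha beta; rewrite big_ord_recl/= mul1r mulr_div_norm_le//.
under eq_bigr => j _ do rewrite mulrCA mulr_div_norm_le// mulrBr.
rewrite sumrB -mulr_suml sum_dirichlet mul1r addrC subrK.
rewrite CE trig_form_interpolation.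
by apply: eq_bigr => j _; rewrite CE.
Qed.

Lemma gamma_bound_gt0 (R : realType) (L : nat) :
  (0 < L)%N -> 0 < gamma_bound (spin R L).
Proof.
move=> L0; rewrite /gamma_bound !mulr_gt0 ?expR_gt0 ?sqrtr_gt0//.
rewrite powR_gt0// /spin; have : (1 : R) <= L%:R by rewrite ler1n.
by move=> ?; nra.
Qed.

(** Here x = 2L(L + 1) >= 2L + 1 >= 1, so x^(3/2) >= 2L + 1, while sqrt 2 <= 2 <= e bounds the
    prefactor by 1. *)
Lemma gamma_bound_le (R : realType) (L : nat) :
  (0 < L)%N -> L.*2.+1%:R * gamma_bound (spin R L) <= 1.
Proof.
move=> L0; rewrite /gamma_bound /spin.
have l1 : (1 : R) <= L%:R by rewrite ler1n.
set x := _ * (2 * _ + 1).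
have xL : L.*2.+1%:R <= x.
  by rewrite -natr1 -muln2 natrM /x; nra.
have x1 : 1 <= x by apply: le_trans xL; rewrite ler1n.
have p0 : 0 < x `^ (3 / 2) by rewrite powR_gt0// (lt_le_trans _ x1).
have px : x <= x `^ (3 / 2) by apply: le1r_powR => //; lra.
have se : Num.sqrt 2 * expR (- 1) <= 1 :> R.
  rewrite expRN ler_pdivrMr ?expR_gt0// mul1r.
  apply: le_trans (expR_ge1Dx 1).
  by rewrite -[leRHS]ger0_norm// -sqrtr_sqr ler_wsqrtr// expr2; lra.
rewrite powRN mulrA ler_pdivrMr// mul1r.
apply: le_trans px; apply: le_trans xL.
by rewrite ler_piMr.
Qed.

(** * Part B: chain length, choice of angles and violation *)

Lemma ex_chain_length (R : realType) (P eps Delta : R) :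
  4 <= P -> 0 <= eps -> 0 < Delta -> Delta <= 2 ->
  eps < - (Num.sqrt 2 * P) + Num.sqrt ((Num.sqrt 2 * P) ^+ 2 + Delta ^+ 2 / 4) ->
  exists k : nat,
    k.*2.+2%:R * (eps + P / k.*2.+1%:R ^+ 2) < Delta.
Proof.
move=> P4 e0 D0 D2 eK.
(* Squaring the hypothesis gives 2 K eps < Delta^2 / 4; then use sqrt 2 >= 7/5. *)
have eP : 56 * (P * eps) <= 5 * Delta ^+ 2.
  have s14 : 7 / 5 <= Num.sqrt 2 :> R.
    by rewrite -[leLHS]ger0_norm// -sqrtr_sqr ler_wsqrtr//; lra.
  set K := Num.sqrt 2 * P in eK.
  have KP : 7 / 5 * P <= K by rewrite ler_wpM2r//; lra.
  have : (eps + K) ^+ 2 < K ^+ 2 + Delta ^+ 2 / 4.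
    rewrite -ltr_sqrt ?sqrtr_sqr; last by nra.
    by rewrite ger0_norm; lra.
  by nra.
(* The chain has n = 2k + 1 links, with n just above 2 P / Delta. *)
pose a := 2 * P / Delta.
have aD : a * Delta = 2 * P by rewrite /a divfK// gt_eqF.
have a4 : 4 <= a by rewrite /a ler_pdivlMr//; nra.
have : 0 <= (a + 1) / 2 by lra.
move=> /truncn_itv; set k := Num.trunc _ => /andP[k1 k2].
exists k.
have nE : k.*2.+1%:R = 2 * k%:R + 1 :> R by rewrite -natr1 -muln2 natrM mulrC.
rewrite -[k.*2.+2%:R]natr1 nE; rewrite -[k.+1%:R]natr1 in k2.
set n := 2 * k%:R + 1.
have na : a < n by rewrite /n; lra.
have na2 : n <= a + 2 by rewrite /n; lra.
have ae : 28 / 5 * (a * eps) <= Delta.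
  rewrite -(ler_pM2r D0); nra.
have Pn : P / n <= Delta / 2.
  by rewrite ler_pdivrMr; nra.
have Pn2 : P / n ^+ 2 <= Delta / 8.
  rewrite ler_pdivrMr ?exprn_gt0//; last by lra.
  by nra.
(* Since a >= 4, (n + 1) eps <= (7/4) a eps <= (5/16) Delta, so the total is at most (5/16 + 1/2 +
   1/8) Delta = (15/16) Delta. *)
rewrite mulrDr (_ : (n + 1) * (P / _) = P / n + P / n ^+ 2); last first.
  by field; lra.
by nra.
Qed.

(** Subtract the integer nearest to t / (2 pi), obtained as a floor after adding 1/2. *)
Lemma ex_angle_mod2pi (R : realType) (t : R) :
  exists z : int, `|t + z%:~R * (2 * pi)| <= pi.
Proof.
have p0 := pi_gt0 R.
exists (- Num.floor (t / (2 * pi) + 2^-1)).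
have /andP[] := floor_itv (t / (2 * pi) + 2^-1).
set v := Num.floor _; rewrite rmorphD/= rmorphN/= => v1 v2.
have tE : t = t / (2 * pi) * (2 * pi) by rewrite divfK// mulf_neq0// gt_eqF.
rewrite ler_norml; move: (t / _) tE v1 v2 => q -> v1 v2.
by apply/andP; split; nra.
Qed.

Lemma relational_part_max (R : realType) (L : nat) (c s : nat -> int -> R)
    (t : R) :
  (forall alpha beta, `|trig_form L c s alpha beta| <= 1) ->
  `|relational_part L c s t| <= 1.
Proof.
move=> C1; have := relational_part_average L c s t 0; rewrite subr0 => E.
rewrite -(ler_pM2l (_ : 0 < L.*2.+1%:R)) ?ltr0n// mulr1 -(normr_nat R L.*2.+1).
rewrite -normrM -E (le_trans (ler_norm_sum _ _ _))//.
rewrite (le_trans (ler_sum _ (fun j _ => C1 _ _)))//.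
by rewrite sumr_const card_ord normr_nat.
Qed.

(* Averaging the chain over common rotations of all settings by the grid
   angles leaves only the relational part. *)
Lemma ex_rotated_chain (R : realType) (L k : nat) (c s : nat -> int -> R)
    (theta d : R) :
  (k.*2%:R < k.+1%:R * relational_part L c s (theta + d)
    + k%:R * relational_part L c s (theta - d)
    - relational_part L c s (theta + k.*2.+1%:R * d)) ->
  violates_braunstein_caves (trig_form L c s).
Proof.
set rel := relational_part L c s => lt_rel.
(* With N = 2k + 2, x_{2i-1} - y_{2i} = theta + d, x_{2i+1} - y_{2i} = theta - d and x_1 - y_N =
   theta + (N - 1) d; [u] is the common rotation. *)
pose x (u : R) (i : nat) := theta - i%:R * d + u.
pose y (u : R) (i : nat) := - (i%:R * d) + u.
pose chain u := \sum_(1 <= i < k.+2) trig_form L c s (x u i.*2.-1) (y u i.*2)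
  + \sum_(1 <= i < k.+1) trig_form L c s (x u i.*2.+1) (y u i.*2)
  - trig_form L c s (x u 1%N) (y u k.*2.+2).
have chainE : \sum_(j < L.*2.+1) chain (grid R L.*2.+1 j) =
    L.*2.+1%:R * (k.+1%:R * rel (theta + d) + k%:R * rel (theta - d)
      - rel (theta + k.*2.+1%:R * d)).
  rewrite sumrB big_split/= exchange_big/= [X in _ + X - _]exchange_big/=.
  rewrite relational_part_average.
  under eq_bigr do rewrite relational_part_average.
  under [X in _ + X - _]eq_bigr do rewrite relational_part_average.
  rewrite (eq_big_nat _ _
    (F2 := fun=> L.*2.+1%:R * rel (theta + d))); last first.
    move=> [//|i] _; congr (_ * rel _).
    by rewrite doubleS/= -(natr1 i.*2.+1); ring.
  rewrite [X in _ + X - _](eq_big_nat _ _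
    (F2 := fun=> L.*2.+1%:R * rel (theta - d))); last first.
    by move=> i _; congr (_ * rel _); rewrite -natr1; ring.
  rewrite !sumr_const_nat !subn1/=.
  rewrite -[_ *+ k.+1]mulr_natr -[_ *+ k]mulr_natr.
  rewrite (_ : theta - 1 * d - - (k.*2.+2%:R * d)
               = theta + k.*2.+1%:R * d); last first.
    by rewrite -(natr1 k.*2.+1); ring.
  by rewrite -/rel; ring.
(* If no rotation exceeded N - 2 = 2k, neither would the average. *)
have [/existsP[j jlt]|/existsPn no] :=
  boolP [exists j : 'I_L.*2.+1, k.*2%:R < chain (grid R L.*2.+1 j)].
  exists k.*2.+2, (x (grid R L.*2.+1 j)), (y (grid R L.*2.+1 j)).
  split => //; first by rewrite /= odd_double.
  rewrite /braunstein_caves /= doubleK.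
  rewrite -(natrB _ (isT : (2 <= k.*2.+2)%N)) subSS subSS subn0.
  by apply: lt_le_trans jlt _; exact: ler_norm.
exfalso; move: lt_rel; rewrite -(ltr_pM2l (_ : 0 < L.*2.+1%:R)) ?ltr0n// -chainE.
rewrite ltNge => /negP; apply.
rewrite mulr_natl -[in leRHS](card_ord L.*2.+1) -sumr_const.
by apply: ler_sum => j _; rewrite leNgt no.
Qed.

Lemma relational_part_violation (R : realType) (L : nat) (c s : nat -> int -> R)
    (Theta_plus Theta_minus epsilon Delta : R) :
  (0 < L)%N ->
  (forall alpha beta, `|trig_form L c s alpha beta| <= 1) ->
  0 <= epsilon -> 0 < Delta ->
  1 - epsilon <= relational_part L c s Theta_plus ->
  relational_part L c s Theta_minus <= 1 - Delta ->
  epsilon < - K_bound (spin R L)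
            + Num.sqrt (K_bound (spin R L) ^+ 2 + Delta ^+ 2 / 4) ->
  violates_braunstein_caves (trig_form L c s).
Proof.
move=> L0 C1 e0 D0 rel_plus rel_minus eK.
have rel1 t := relational_part_max t C1.
have l1 : (1 : R) <= L%:R by rewrite ler1n.
(* Chosen so that the second-difference bound is 2 S d^2 and K_J = sqrt 2 * S * pi^2. *)
set S : R := L%:R * (L%:R + 1) * (2 * L%:R + 1) / 6.
have S1 : 1 <= S by rewrite /S ler_pdivlMr//; nra.
have KE : K_bound (spin R L) = Num.sqrt 2 * (S * pi ^+ 2).
  by rewrite /K_bound /spin /S; field.
have D2 : Delta <= 2.
  by have := rel1 Theta_minus; rewrite ler_norml => /andP[]; lra.
have P4 : 4 <= S * pi ^+ 2.
  have : 2 ^+ 2 <= pi ^+ 2 :> R by rewrite lerXn2r ?nnegrE ?pi_ge0 ?pi_ge2.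
  by nra.
rewrite KE in eK; have [k kD] := ex_chain_length P4 e0 D0 D2 eK.
have [z] := ex_angle_mod2pi (Theta_minus - Theta_plus).
set D := _ + z%:~R * _ => Dpi.
have n0 : k.*2.+1%:R != 0 :> R by rewrite pnatr_eq0.
pose d := D / k.*2.+1%:R.
have dE : k.*2.+1%:R * d = D by rewrite /d [LHS]mulrC divfK.
apply: (@ex_rotated_chain R L k c s Theta_plus d).
rewrite (_ : Theta_plus + k.*2.+1%:R * d = Theta_minus + z%:~R * (2 * pi)); last first.
  by rewrite dE /D; ring.
rewrite relational_part_int2pi.
have d2 : S * d ^+ 2 <= S * pi ^+ 2 / k.*2.+1%:R ^+ 2.
  rewrite /d exprMn mulrA exprVn ler_wpM2r ?invr_ge0 ?exprn_ge0//.
  rewrite ler_wpM2l//; first by lra.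
  by rewrite -(real_normK (num_real D)) lerXn2r ?nnegrE// pi_ge0.
have := relational_part_second_difference Theta_plus d rel1.
rewrite (_ : _ / 3 = 2 * S); last by rewrite /S; field.
rewrite ler_norml => /andP[lb _].
have := rel1 (Theta_plus - d); rewrite ler_norml => /andP[_ ub].
have kk : k.*2.+2%:R = 2 * k%:R + 2 :> R.
  by rewrite -doubleS -mul2n natrM -natr1; ring.
have kk0 : k.*2%:R = 2 * k%:R :> R by rewrite -mul2n natrM.
rewrite kk0 -natr1; rewrite kk in kD.
have k1 : 0 <= k%:R + 1 :> R by rewrite addr_ge0.
set rp := relational_part L c s (_ + d) in lb *.
set rm := relational_part L c s (_ - d) in lb ub *.
set e := S * d ^+ 2 in d2.
have pair : 2 - 2 * epsilon - 2 * e <= rp + rm by rewrite /e; lra.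
(* The chain is k + 1 pairs minus one [rm] <= 1 and minus the value at [Theta_minus]: at least 2k +
   Delta - (2k + 2)(epsilon + e). *)
have := ler_wpM2l k1 pair.
have : (2 * k%:R + 2) * (epsilon + e) < Delta.
  by apply: le_lt_trans kD; rewrite ler_wpM2l// ?lerD2l//; lra.
by lra.
Qed.

Theorem theorem2 (R : realType) (twoJ : nat) (twoJ_gt0 : (0 < twoJ)%N)
    (C : R -> R -> R) (c s : nat -> int -> R)
    (C_corr : correlation_function C)
    (C_form : forall alpha beta : R,
        C alpha beta = trig_form twoJ c s alpha beta) :
  ((forall alpha beta : R,
       `|C alpha beta - c 0%N 0|
         <= gamma_bound (spin R twoJ) * (1 - `|c 0%N 0|)) ->
   has_LHV_model C)
  /\
  (forall Theta_plus Theta_minus epsilon Delta : R,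
     0 <= epsilon -> 0 < Delta ->
     1 - epsilon <= relational_part twoJ c s Theta_plus ->
     relational_part twoJ c s Theta_minus <= 1 - Delta ->
     epsilon < - K_bound (spin R twoJ)
               + Num.sqrt (K_bound (spin R twoJ) ^+ 2 + Delta ^+ 2 / 4) ->
     violates_braunstein_caves C).
Proof.
split=> [small|Tp Tm eps Delta e0 D0 rel_plus rel_minus eK].
  exact: trig_form_LHV C_form (gamma_bound_gt0 R twoJ_gt0)
    (gamma_bound_le R twoJ_gt0) small.
rewrite (_ : C = trig_form twoJ c s); last by apply/funext => a; apply/funext => b.
apply: (relational_part_violation twoJ_gt0 _ e0 D0 rel_plus rel_minus eK).
by move=> a b; rewrite -C_form ler_norml; case: C_corr.
Qed.
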